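(* Let $k\in\{3,4,5,6\}$, $\sigma\geqslant 0$, $\tau>0$, and let $\mu_1,\dots,\mu_k$ be the real numbers listed in the context. For any positive integer $N$ and any $w^1,\dots,w^N\in V$, with the convention $w^m:=0$ for $m\leqslant 0$, it holds that $$\sum_{n=1}^{N}\Big\langle w^n,\;w^n-\sum_{j=1}^k\mu_j e^{-\sigma j\tau}w^{n-j}\Big\rangle\geqslant c_k\sum_{n=1}^N\|w^n\|^2,$$ where $(c_3,c_4,c_5,c_6)=\left(\frac12,\frac12,\frac14,\frac1{24}\right)$ (if the scalars are complex, the left-hand side is replaced by its real part).
   Context: $A$ is a positive definite, selfadjoint, linear operator on a Hilbert space $(H,(\cdot,\cdot))$ with domain $D(A)$ dense in $H$; $V:=D(A^{1/2})$ carries the inner product $\langle w,v\rangle:=(A^{1/2}w,A^{1/2}v)$ and the norm $\|v\|=\langle v,v\rangle^{1/2}$. The numbers $\mu_j$ (those not listed are $0$) are: $k=3$ and $k=4$: $\mu_1=\frac12$. $k=5$: $\mu_1=1$, $\mu_2=-\frac14$. $k=6$: $\mu_1=\frac{43}{30}$, $\mu_2=-\frac23$, $\mu_3=\frac1{10}$. *)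

(* Defs.v *)
From HB Require Import structures.
From mathcomp Require Import all_boot all_order all_algebra.
From mathcomp Require Import complex.
From mathcomp Require Import all_classical all_reals all_analysis.

Set Implicit Arguments.
Unset Strict Implicit.
Unset Printing Implicit Defensive.

Import Order.TTheory GRing.Theory Num.Theory.
Import numFieldNormedType.Exports.

Local Open Scope classical_set_scope.
Local Open Scope ring_scope.

(* The scalars of the Hilbert space are either the reals or the complexes. *)
Variant scalar_kind := RealScalars | ComplexScalars.

Definition scalars (R : realType) (s : scalar_kind) : numFieldType :=
  match s with
  | RealScalars => R : numFieldType
  | ComplexScalars => R[i] : numFieldType
  end.

Definition sconj (R : realType) (s : scalar_kind) :
    scalars R s -> scalars R s :=
  match s with
  | RealScalars => fun x : R => x
  | ComplexScalars => fun z : R[i] => conjc z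
  end.

Definition sRe (R : realType) (s : scalar_kind) : scalars R s -> R :=
  match s with
  | RealScalars => fun x : R => x
  | ComplexScalars => fun z : R[i] => complex.Re z
  end.

Definition of_real (R : realType) (s : scalar_kind) : R -> scalars R s :=
  match s with
  | RealScalars => fun x : R => x
  | ComplexScalars => fun x : R => real_complex R x
  end.

(* A possibly unbounded linear operator in H: [op] is a total function, but
   only its values on the subspace [dom] are meaningful. *)
Record linop (K : numFieldType) (H : lmodType K) := LinOp {
  dom : set H ;
  op :> H -> H ;
  dom0 : dom 0 ;
  domP : forall (a : K) (u v : H), dom u -> dom v -> dom (a *: u + v) ;
  opP : forall (a : K) (u v : H), dom u -> dom v ->
          op (a *: u + v) = a *: op u + op v
}.

Section Operators.
Variables (R : realType) (s : scalar_kind).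
Variables (H : completeNormedModType (scalars R s)).
(* linear in the first argument, conjugate-linear in the second *)
Variable dot : {dot H for @sconj R s}.

(* Completeness being part of [completeNormedModType], this says that
   (H, dot) is a Hilbert space. *)
Definition norm_of_dot : Prop := forall u : H, `|u| ^+ 2 = dot u u.

(* [(y, z)] is in the graph of the adjoint of [A]. *)
Definition adjoint_graph (A : linop H) (y z : H) : Prop :=
  forall x, dom A x -> dot (A x) y = dot x z.

Definition selfadjoint (A : linop H) : Prop :=
  dense (dom A) /\
  forall y z, adjoint_graph A y z <-> (dom A y /\ A y = z).

(* Over the complexes, [0 < z] and [0 <= z] entail that [z] is real. *)
Definition positive_definite (A : linop H) : Prop :=
  forall u, dom A u -> u != 0 -> 0 < dot (A u) u.

Definition nonnegative (A : linop H) : Prop :=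
  forall u, dom A u -> 0 <= dot (A u) u.

(* [S] is A^(1/2), the nonnegative selfadjoint operator whose square, on its
   natural domain {u in D(S) | S u in D(S)}, is [A]. *)
Definition is_sqrt_op (S A : linop H) : Prop :=
  [/\ selfadjoint S,
      nonnegative S,
      forall u, dom A u <-> (dom S u /\ dom S (S u)) &
      forall u, dom A u -> S (S u) = A u].

(* Inner product and norm of V = dom S, where S = A^(1/2). *)
Definition Vdot (S : linop H) (u v : H) : scalars R s := dot (S u) (S v).

Definition Vnorm (S : linop H) (v : H) : R := Num.sqrt (sRe (Vdot S v v)).

End Operators.

Definition mu (R : realType) (k j : nat) : R :=
  match k, j with
  | 3, 1 => 1 / 2%:R
  | 4, 1 => 1 / 2%:R
  | 5, 1 => 1
  | 5, 2 => - (1 / 4%:R)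
  | 6, 1 => 43%:R / 30%:R
  | 6, 2 => - (2%:R / 3%:R)
  | 6, 3 => 1 / 10%:R
  | _, _ => 0
  end.

(* only the values at k = 3, 4, 5, 6 are meaningful *)
Definition c_ (R : realType) (k : nat) : R :=
  match k with
  | 3 => 1 / 2%:R
  | 4 => 1 / 2%:R
  | 5 => 1 / 4%:R
  | 6 => 1 / 24%:R
  | _ => 0
  end.

(* Main.v *)
Require Import Defs.
From HB Require Import structures.
From mathcomp Require Import all_boot all_order all_algebra.
From mathcomp Require Import complex.
From mathcomp Require Import all_classical all_reals all_analysis.
From mathcomp Require Import zify ring lra.

Set Implicit Arguments.
Unset Strict Implicit.
Unset Printing Implicit Defensive.

Import Order.TTheory GRing.Theory Num.Theory.
Import numFieldNormedType.Exports.

Local Open Scope classical_set_scope.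
Local Open Scope ring_scope.

(** Put x^n = A^(1/2) w^n, cut off after N, and let R_j be the sum over n of the real parts of (x^n,
    x^(n-j)); taking real parts makes the pairing symmetric and treats both kinds of scalars at
    once. With r = exp(- sigma tau) in (0, 1], the claim becomes c_k R_0 <= R_0 - sum_j mu_j r^j
    R_j. As x has finite support, nonnegativity of sum_n |sum_i g_i x^(n-i)|^2 is a linear
    inequality between the R_j ([autocorrelation_toeplitz_ge0]). It therefore suffices to write 1 -
    c_k - sum_j mu_j r^j cos(j t) as a nonnegative combination of squared moduli of trigonometric
    polynomials, uniformly in r; [autocorrelation_mu_ge] does this without any Fourier transform. *)

Definition rdot (R : realType) (s : scalar_kind)
    (H : completeNormedModType (scalars R s)) (dot : {dot H for @sconj R s})
    (u v : H) : R := sRe (dot u v).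

Section RealInnerProduct.
Context (R : realType) (s : scalar_kind).

Lemma sRe0 : sRe (0 : scalars R s) = 0.
Proof. by case: s. Qed.

Lemma sReD : {morph @sRe R s : x y / x + y}.
Proof. by case: s => //= -[a b] [c d]. Qed.

Lemma sRe_of_realM (a : R) (x : scalars R s) : sRe (of_real s a * x) = a * sRe x.
Proof. by case: s x => //= -[b c] /=; rewrite mul0r subr0. Qed.

Lemma sRe_conj (x : scalars R s) : sRe (sconj x) = sRe x.
Proof. by case: s x => //= -[b c]. Qed.

Lemma sRe_ge0 (x : scalars R s) : 0 <= x -> 0 <= sRe x.
Proof. by case: s x => //= -[b c]; rewrite lecE /= => /andP[]. Qed.

Context (H : completeNormedModType (scalars R s)) (dot : {dot H for @sconj R s}).
Local Notation P := (rdot dot).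

Lemma rdotC (u v : H) : P u v = P v u.
Proof.
rewrite /rdot (@hermitian_subproof _ _ _ _ dot u v) expr0 mul1r.
exact: sRe_conj.
Qed.

Lemma rdotDl (u v x : H) : P (u + v) x = P u x + P v x.
Proof. by rewrite /rdot linearDl; apply: sReD. Qed.

Lemma rdotZl a (u v : H) : P (of_real s a *: u) v = a * P u v.
Proof. by rewrite /rdot linearZl_LR; apply: sRe_of_realM. Qed.

Lemma rdot0l (u : H) : P 0 u = 0.
Proof. by rewrite /rdot linear0l; apply: sRe0. Qed.

Lemma rdot_ge0 (u : H) : 0 <= P u u.
Proof.
apply: sRe_ge0; have [->|u0] := eqVneq u 0; first by rewrite linear0l.
exact/ltW/neq0_dnorm_gt0.
Qed.

Lemma rdot0r (u : H) : P u 0 = 0.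
Proof. by rewrite rdotC rdot0l. Qed.

Lemma rdotZr a (u v : H) : P u (of_real s a *: v) = a * P u v.
Proof. by rewrite rdotC rdotZl rdotC. Qed.

Lemma rdotDr (u x y : H) : P u (x + y) = P u x + P u y.
Proof. by rewrite rdotC rdotDl !(rdotC u). Qed.

Lemma rdotBr (u x y : H) : P u (x - y) = P u x - P u y.
Proof. by apply/eqP; rewrite eq_sym subr_eq -rdotDr subrK. Qed.

Lemma rdot_sumr (u : H) (I : Type) (t : seq I) (F : I -> H) :
  P u (\sum_(i <- t) F i) = \sum_(i <- t) P u (F i).
Proof.
elim: t => [|i t IH]; first by rewrite !big_nil rdot0r.
by rewrite !big_cons rdotDr IH.
Qed.

Definition autocorrelation (x : int -> H) (N j : nat) : R :=
  \sum_(1 <= n < N.+1) P (x n%:Z) (x (n%:Z - j%:Z)).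

Lemma autocorrelation_ge0 (x : int -> H) N : 0 <= autocorrelation x N 0.
Proof. by apply: sumr_ge0 => n _; rewrite subr0 rdot_ge0. Qed.

(* A Toeplitz quadratic form in the autocorrelations of [x] is the squared norm
   of the filter [g] applied to [x]; the window must extend past [N] for this,
   hence the vanishing of [x] beyond [N]. *)
Lemma autocorrelation_toeplitz_ge0 (x : int -> H) N (g0 g1 g2 g3 : R) :
    (forall m : int, m <= 0 -> x m = 0) ->
    (forall m : int, N%:Z < m -> x m = 0) ->
  0 <= (g0 ^+ 2 + g1 ^+ 2 + g2 ^+ 2 + g3 ^+ 2) * autocorrelation x N 0
     + 2 * (g0 * g1 + g1 * g2 + g2 * g3) * autocorrelation x N 1
     + 2 * (g0 * g2 + g1 * g3) * autocorrelation x N 2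
     + 2 * (g0 * g3) * autocorrelation x N 3.
Proof.
move=> x0 xN.
(* Translating by a at most 3 keeps the support 1..N inside the window 1..N+3; the terms outside
   a+1..N+a vanish through their first factor. *)
have shift (a j : nat) : (a <= 3)%N ->
    \sum_(1 <= n < N.+4) P (x (n%:Z - a%:Z)) (x (n%:Z - (a + j)%:Z)) =
    autocorrelation x N j.
  move=> a3.
  rewrite (big_cat_nat (n := a.+1)) //=; last by lia.
  rewrite (big_cat_nat (n := N + a.+1) (m := a.+1)) //=; [|by lia|by lia].
  rewrite big_nat big1 ?add0r; last first.
    by move=> n /andP[_ na]; rewrite x0 ?rdot0l//; lia.
  rewrite [X in _ + X]big_nat [X in _ + X]big1 ?addr0; last first.
    by move=> n /andP[na _]; rewrite xN ?rdot0l//; lia.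
  rewrite -[a.+1]add1n addnA addn1 big_addn addnK /autocorrelation.
  by apply: eq_big_nat => n _; congr (P (x _) (x _)); lia.
pose v (n : nat) := of_real s g0 *: x n%:Z + of_real s g1 *: x (n%:Z - 1)
  + of_real s g2 *: x (n%:Z - 2%:Z) + of_real s g3 *: x (n%:Z - 3%:Z).
rewrite [leRHS](_ : _ = \sum_(1 <= n < N.+4) P (v n) (v n)).
  by apply: sumr_ge0 => n _; apply: rdot_ge0.
pose D a j := \sum_(1 <= n < N.+4) P (x (n%:Z - a%:Z)) (x (n%:Z - (a + j)%:Z)).
(* The product of the coefficients at positions a and a + j multiplies [D a j], which by [shift]
   depends on the lag j only. *)
symmetry; transitivity (g0 ^+ 2 * D 0%N 0%N + g1 ^+ 2 * D 1%N 0%N + g2 ^+ 2 * D 2%N 0%N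
    + g3 ^+ 2 * D 3%N 0%N
    + 2 * (g0 * g1) * D 0%N 1%N + 2 * (g1 * g2) * D 1%N 1%N
    + 2 * (g2 * g3) * D 2%N 1%N
    + 2 * (g0 * g2) * D 0%N 2%N + 2 * (g1 * g3) * D 1%N 2%N
    + 2 * (g0 * g3) * D 0%N 3%N); last first.
  by rewrite /D !shift //; ring.
rewrite /D !mulr_sumr -!big_split /=; apply: eq_bigr => n _.
rewrite /v !(rdotDl, rdotDr, rdotZl, rdotZr) !subr0.
rewrite (rdotC (x (n%:Z - 1)) (x n)) (rdotC (x (n%:Z - 2%:Z)) (x n)).
rewrite (rdotC (x (n%:Z - 3%:Z)) (x n)).
rewrite (rdotC (x (n%:Z - 2%:Z)) (x (n%:Z - 1))).
rewrite (rdotC (x (n%:Z - 3%:Z)) (x (n%:Z - 1))).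
rewrite (rdotC (x (n%:Z - 3%:Z)) (x (n%:Z - 2%:Z))).
ring.
Qed.

(* Writing R_j as cos(j t) and y := r cos t, the trigonometric polynomial to be
   bounded is, for k = 5,
     (y - 1)^2 / 2 + (1 - r^2) / 4,
   and, for k = 6,
     2/5 (1 - y) (y - 3/5)^2 + 34/75 (y - 191/340)^2 + d
       + (1 - r^2) (2/3 - 3/10 y)     with d > 0,
   where 1 - y = (1 - r) + r |1 - e^(it)|^2 / 2.  Each summand is a nonnegative
   combination of the Toeplitz forms invoked below. *)
Lemma autocorrelation_mu_ge (x : int -> H) N k (r : R) :
    k \in [:: 3; 4; 5; 6]%N -> 0 <= r <= 1 ->
    (forall m : int, m <= 0 -> x m = 0) ->
    (forall m : int, N%:Z < m -> x m = 0) ->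
  c_ R k * autocorrelation x N 0 <=
  autocorrelation x N 0
    - \sum_(1 <= j < k.+1) mu R k j * r ^+ j * autocorrelation x N j.
Proof.
move=> hk /andP[r0 r1] x0 xN.
have R0_ge0 := autocorrelation_ge0 x N.
have Q g0 g1 g2 g3 := autocorrelation_toeplitz_ge0 g0 g1 g2 g3 x0 xN.
have r_sq : 0 <= 1 - r ^+ 2 by rewrite subr_ge0 expr_le1.
have one_sub_r : 0 <= 1 - r by rewrite subr_ge0.
have Q1 := mulr_ge0 r0 (Q 1 (-1) 0 0).
move: hk; rewrite !inE => /or4P[] /eqP->;
  rewrite unlock /= /mu /c_ ?mul0r ?addr0 ?expr1.
- have Q0 := mulr_ge0 one_sub_r R0_ge0; lra.
- have Q0 := mulr_ge0 one_sub_r R0_ge0; lra.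
(* A filter (r/2, -c, r/2) has symbol r cos t - c up to a phase, so its form stands for (y -
   c)^2. *)
- have Q2 := Q (r / 2) (-1) (r / 2) 0.
  have Q0 := mulr_ge0 r_sq R0_ge0; lra.
- have Q2 := mulr_ge0 one_sub_r (Q (r / 2) (- (3 / 5)) (r / 2) 0).
  (* This filter is the product (1 - z) (r/2 - 3/5 z + r/2 z^2), which gives r |1 - e^(it)|^2 (y -
     3/5)^2. In [Q4], 191/340 comes from completing the square in what remains. *)
  have Q3 := mulr_ge0 r0 (Q (r / 2) (- (3 / 5) - r / 2) (3 / 5 + r / 2) (- (r / 2))).
  have Q4 := Q (r / 2) (- (191 / 340)) (r / 2) 0.
  have Q5 := mulr_ge0 r_sq R0_ge0.
  have Q6 := mulr_ge0 r_sq (mulr_ge0 one_sub_r R0_ge0).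
  have Q7 := mulr_ge0 r_sq Q1.
  lra.
Qed.

End RealInnerProduct.

Lemma op0 (K : numFieldType) (H : lmodType K) (S : linop H) : S 0 = 0.
Proof.
have := opP 1 (dom0 S) (dom0 S); rewrite !scale1r addr0 => S0D.
by apply: (addrI (S 0)); rewrite addr0 -S0D.
Qed.

Lemma opB (K : numFieldType) (H : lmodType K) (S : linop H) (u v : H) :
  dom S u -> dom S v -> S (u - v) = S u - S v.
Proof.
by move=> du dv; have := opP (-1) dv du; rewrite !scaleN1r !(addrC (- _)).
Qed.

(** Linearity of [S] is only available on its domain, so the induction has to carry membership of
    the partial sums along with the value. *)
Lemma dom_op_sum (K : numFieldType) (H : lmodType K) (S : linop H) (I : Type)
    (t : seq I) (a : I -> K) (u : I -> H) : (forall i, dom S (u i)) ->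
  dom S (\sum_(i <- t) a i *: u i) /\
  S (\sum_(i <- t) a i *: u i) = \sum_(i <- t) a i *: S (u i).
Proof.
move=> hu; elim: t => [|i t [IHd IHe]].
  by rewrite !big_nil op0; split=> //; exact: dom0.
by rewrite !big_cons opP // IHe; split=> //; apply: domP.
Qed.

Theorem lemma3p3 (R : realType) (s : scalar_kind)
    (H : completeNormedModType (scalars R s))
    (dot : {dot H for @sconj R s}) (hdot : norm_of_dot dot)
    (A : linop H) (hAsa : selfadjoint dot A) (hApd : positive_definite dot A)
    (sqrtA : linop H) (hsqrtA : is_sqrt_op dot sqrtA A)
    (k : nat) (hk : k \in [:: 3; 4; 5; 6]%N)
    (sigma tau : R) (hsigma : 0 <= sigma) (htau : 0 < tau)
    (N : nat) (hN : (0 < N)%N)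
    (w : int -> H)
    (hwV : forall n : nat, (1 <= n <= N)%N -> dom sqrtA (w n%:Z))
    (hw0 : forall m : int, m <= 0 -> w m = 0) :
  sRe (\sum_(1 <= n < N.+1)
         Vdot dot sqrtA (w n%:Z)
           (w n%:Z - \sum_(1 <= j < k.+1)
              of_real s (mu R k j * expR (- (sigma * j%:R * tau)))
                *: w (n%:Z - j%:Z)))
  >= c_ R k * \sum_(1 <= n < N.+1) Vnorm dot sqrtA (w n%:Z) ^+ 2.
Proof.
pose r : R := expR (- (sigma * tau)).
have r01 : 0 <= r <= 1.
  by rewrite expR_ge0 expR_le1 oppr_le0 mulr_ge0 // ltW.
(* Beyond N the sequence [w] is arbitrary and may leave the domain; the cut-off supplies finite
   support and changes no term of the sums, whose indices n - j never exceed N. *)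
pose x (m : int) : H := if m <= N%:Z then sqrtA (w m) else 0.
have x0 (m : int) : m <= 0 -> x m = 0.
  by move=> m0; rewrite /x hw0 // op0 if_same.
have xN (m : int) : N%:Z < m -> x m = 0 by move=> Nm; rewrite /x leNgt Nm.
have w_dom (m : int) : m <= N%:Z -> dom sqrtA (w m).
  case: (lerP m 0) => [m0 _|]; first by rewrite hw0 //; exact: dom0.
  by case: m => // n n0 nN; apply: hwV; lia.
have := autocorrelation_mu_ge dot hk r01 x0 xN.
(* It remains to identify R_0 with the sum of squared V-norms, and the combination of the R_j with
   the left-hand side after exchanging the sums over n and j. *)
congr (_ * _ <= _).
  apply: eq_big_nat => n /andP[_ nN]; rewrite subr0 /x lez_nat -ltnS nN.
  by rewrite sqr_sqrtr // rdot_ge0.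
rewrite (big_morph _ (@sReD R s) (sRe0 R s)).
rewrite /autocorrelation; under [X in _ - X]eq_bigr => j _ do rewrite mulr_sumr.
rewrite exchange_big -sumrB; apply: eq_big_nat => n /andP[_ nN].
have xS (j : nat) : x (n%:Z - j%:Z) = sqrtA (w (n%:Z - j%:Z)).
  by rewrite /x ifT //; lia.
have w_dom_lag (j : nat) : dom sqrtA (w (n%:Z - j%:Z)) by apply: w_dom; lia.
have [sum_dom sum_op] := @dom_op_sum _ _ sqrtA _ (index_iota 1 k.+1)
  (fun j : nat => of_real s (mu R k j * expR (- (sigma * j%:R * tau))))
  (fun j : nat => w (n%:Z - j%:Z)) w_dom_lag.
rewrite /Vdot opB //; last by apply: w_dom; lia.
rewrite sum_op -[RHS]/(rdot dot _ _) rdotBr rdot_sumr.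
have xSn := xS 0%N; rewrite subr0 in xSn.
rewrite subr0 xSn; congr (_ - _).
apply: eq_bigr => j _; rewrite rdotZr xS; congr (_ * _ * _).
by rewrite -expRM_natl; congr expR; ring.
Qed.
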